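(* Let $k\ge1$, and let $T$ be any real-valued tolling function defined on finite multisets of quadruples of nonnegative reals. Consider the anonymous tolling scheme in which, on each road $i$ of a network, all vehicle types are charged the same toll $$\tau_i=T\big(\{(z_i^j,\,z_i^{*j},\,a_i^j,\,b_i)\}_{j\in[m]}\big),$$ where $z$ is the current routing, $z^*$ is an optimal routing, and $\{\cdot\}_{j\in[m]}$ is a multiset (vehicle types are treated interchangeably). Then the Price of Anarchy, with these tolls applied, over mixed-autonomy routing instances with affine latencies and maximum degree of asymmetry $k$, is at least $k$.
   Context: Network: a finite directed graph (parallel edges allowed) with $n$ edges (roads), indexed by $i\in[n]=\{1,\dots,n\}$; there are $m$ vehicle types indexed by $j\in[m]$ ($n$ and $m$ may vary between instances). Flow is nonatomic. Demand is inelastic and given by finitely many commodities $r\in[R]$, each with a source node $s_r$, destination node $s'_r$, demand $\beta_r\ge 0$ and vehicle type $j_r\in[m]$; $\mathcal P_r$ is the set of simple paths from $s_r$ to $s'_r$. A feasible path flow assigns $f_{r,p}\ge0$ to each $r\in[R]$, $p\in\mathcal P_r$ with $\sum_{p\in\mathcal P_r}f_{r,p}=\beta_r$. It induces the edge routing $z=(z_i^j)$, where $z_i^j=\sum_{r:\,j_r=j}\ \sum_{p\in\mathcal P_r:\,i\in p}f_{r,p}$ is the flow of type $j$ on road $i$. Write $z_i=(z_i^1,\dots,z_i^m)^T$. The set $\mathcal Z$ of feasible routings is the set of edge routings induced by feasible path flows. Latency: on road $i$ all vehicle types experience the same latency $c_i(z_i)=\sum_{j\in[m]}a_i^jz_i^j+b_i$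 with $a_i^j\ge0$, $b_i\ge0$. Social cost (tolls not counted): $C(z)=\sum_{i\in[n]}\big(\sum_{j\in[m]}z_i^j\big)c_i(z_i)$. A socially optimal routing $z^*$ is a minimizer of $C$ over $\mathcal Z$. Wardrop Equilibrium with tolls: a feasible routing $z$, induced by a feasible path flow $f$, such that for all $r\in[R]$ and $p,p'\in\mathcal P_r$: $f_{r,p}>0$ implies $\sum_{i\in p}(c_i(z_i)+\tau_i)\le\sum_{i\in p'}(c_i(z_i)+\tau_i)$, where the tolls $\tau_i$ are evaluated at $z$ (and the given $z^*$). Maximum degree of asymmetry: $k=\max_{i\in[n],\,j,j'\in[m]}a_i^j/a_i^{j'}$ (ratio taken as $1$ on a road with all $a_i^j=0$). Price of Anarchy with tolls: the supremum, over all instances in the class with $C(z^* )>0$, over optimal routings $z^*$ used in the tolls, and over Wardrop Equilibria $\hat z$ under the tolls, of $C(\hat z)/C(z^* )$. *)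

(* Defs.v *)
From HB Require Import structures.
From mathcomp Require Import all_boot all_order all_algebra.
From mathcomp Require Import finmap multiset.
From mathcomp Require Import boolp classical_sets reals constructive_ereal ereal.

Set Implicit Arguments.
Unset Strict Implicit.
Unset Printing Implicit Defensive.

Import Order.TTheory GRing.Theory Num.Theory.

Local Open Scope classical_set_scope.
Local Open Scope ring_scope.

(* Sign constraints on coefficients, offsets, demands and flows are carried by the
   type [{nonneg R}]; [x%:num] is the underlying element of [R].  Edges are
   ordinals, so parallel edges (equal sources and targets) are allowed. *)
Record instance (R : realType) := Instance {
  node : finType;
  nroads : nat;
  ntypes : nat;
  road_src : 'I_nroads -> node;
  road_dst : 'I_nroads -> node;
  ncomm : nat;
  source : 'I_ncomm -> node;
  dest : 'I_ncomm -> node;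
  demand : 'I_ncomm -> {nonneg R};
  vtype : 'I_ncomm -> 'I_ntypes;
  coef : 'I_nroads -> 'I_ntypes -> {nonneg R};
  offset : 'I_nroads -> {nonneg R}
}.

Section Routing.
Variables (R : realType) (G : instance R).

Notation road := 'I_(nroads G).
Notation vt := 'I_(ntypes G).
Notation comm := 'I_(ncomm G).

Fixpoint walk (x : node G) (p : seq road) (y : node G) : bool :=
  if p is e :: p' then (road_src e == x) && walk (road_dst e) p' y else x == y.

Definition simple_walk (x : node G) (p : seq road) (y : node G) : bool :=
  walk x p y && uniq (x :: [seq road_dst e | e <- p]).

Lemma size_simple_walk x p y : simple_walk x p y -> (size p < #|node G|)%N.
Proof.
case/andP=> _ /card_uniqP; rewrite /= size_map => <-; exact: max_card.
Qed.

(* By [size_simple_walk], bounding the length by the number of nodes loses no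
   simple path; it only serves to make the paths range over a finite type. *)
Definition road_seq := {bseq #|node G| of road}.

Definition paths (r : comm) : pred road_seq :=
  [pred p : road_seq | simple_walk (source r) p (dest r)].

(* The values of a path flow outside [paths r] are never used. *)
Definition path_flow := comm -> road_seq -> {nonneg R}.

Definition feasible_flow (f : path_flow) : Prop :=
  forall r, \sum_(p in paths r) (f r p)%:num = (demand r)%:num.

Definition routing := road -> vt -> {nonneg R}.

Definition induces (f : path_flow) (z : routing) : Prop :=
  forall i j, (z i j)%:num =
    \sum_(r | vtype r == j) \sum_(p in paths r | i \in (p : seq road))
      (f r p)%:num.

Definition feasible (z : routing) : Prop :=
  exists f, feasible_flow f /\ induces f z.

Definition latency (z : routing) (i : road) : R :=
  (\sum_j (coef i j)%:num * (z i j)%:num) + (offset i)%:num.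

Definition social_cost (z : routing) : R :=
  \sum_i (\sum_j (z i j)%:num) * latency z i.

Definition optimal (z : routing) : Prop :=
  feasible z /\ forall z', feasible z' -> social_cost z <= social_cost z'.

Definition wardrop (tau : road -> R) (z : routing) : Prop :=
  exists f, [/\ feasible_flow f, induces f z &
    forall r p p', p \in paths r -> p' \in paths r -> 0 < (f r p)%:num ->
      \sum_(i <- (p : seq road)) (latency z i + tau i) <=
      \sum_(i <- (p' : seq road)) (latency z i + tau i)].

(* Division is that of [\bar R], so that [x / 0 = +oo] for [x > 0]: a road
   where some but not all coefficients vanish has infinite asymmetry;
   there the junk value [0 / 0 = 0] is irrelevant to the maximum. *)
Definition asym_ratio (i : road) (j j' : vt) : \bar R :=
  if [forall l, (coef i l)%:num == 0] then 1%E
  else ((coef i j)%:num%:E / (coef i j')%:num%:E)%E.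

Definition asymmetry : \bar R :=
  \big[maxe/-oo%E]_(i : road) \big[maxe/-oo%E]_(j : vt)
    \big[maxe/-oo%E]_(j' : vt) asym_ratio i j j'.

End Routing.

Definition quadruple (R : realType) : choiceType :=
  ({nonneg R} * {nonneg R} * {nonneg R} * {nonneg R})%type.

Definition tolling (R : realType) := {mset quadruple R}%mset -> R.

Definition toll (R : realType) (T : tolling R) (G : instance R)
    (zopt z : routing G) (i : 'I_(nroads G)) : R :=
  T (seq_mset [seq (z i j, zopt i j, coef i j, offset i) : quadruple R
              | j <- enum 'I_(ntypes G)]).

Definition price_of_anarchy (R : realType) (T : tolling R) (k : R) : \bar R :=
  ereal_sup [set x | exists (G : instance R) (zopt zeq : routing G),
    [/\ asymmetry G = k%:E,
        optimal zopt,
        0 < social_cost zopt,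
        wardrop (toll T zopt zeq) zeq
      & x = (social_cost zeq / social_cost zopt)%:E]].

(* Main.v *)
(** Two parallel roads, two vehicle types of unit demand each; type [i] has
    coefficient [1] on road [i] and [k] on the other road.  It is optimal that
    type [i] uses road [i], at cost [2].  If the types swap roads then every
    latency is [k], for a total cost [2k], and the two roads carry the same
    multiset of quadruples: an anonymous toll charges them equally, so that the
    swapped routing is an equilibrium whatever the tolling function. *)
Require Import Defs.
From mathcomp Require Import all_boot all_order all_algebra.
From mathcomp Require Import reals constructive_ereal.
From mathcomp Require Import multiset ereal interval_inference.
From mathcomp Require Import ring lra.

Import Order.TTheory GRing.Theory Num.Theory.

Local Open Scope ring_scope.

(** At [k = 1] the cost is [s^2 + (2 - s)^2 = 2 + 2 (s - 1)^2] for the load [s = a + b] of the first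
    road; a larger [k] only adds the nonnegative term [gap]. *)
Lemma two_roads_cost_ge2 (R : realFieldType) (k a b c d : R) : 1 <= k ->
  0 <= a -> 0 <= b -> 0 <= c -> 0 <= d -> a + c = 1 -> b + d = 1 ->
  2 <= (a + b) * (a + k * b) + (c + d) * (k * c + d).
Proof.
move=> k1 a0 b0 c0 d0 ac bd.
have gap : 0 <= (k - 1) * ((a + b) * b + (c + d) * c).
  apply: mulr_ge0; first by rewrite subr_ge0.
  by do ![apply: addr_ge0 | apply: mulr_ge0].
have sq : 0 <= (a + b - 1) ^+ 2 by exact: sqr_ge0.
have -> : (a + b) * (a + k * b) + (c + d) * (k * c + d) =
    2 + 2 * (a + b - 1) ^+ 2 + (k - 1) * ((a + b) * b + (c + d) * c).
  have -> : c = 1 - a by rewrite -ac addrAC subrr add0r.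
  have -> : d = 1 - b by rewrite -bd addrAC subrr add0r.
  by ring.
by lra.
Qed.

Definition two_roads {R : realType} (k : {nonneg R}) : instance R :=
  {| node := bool; nroads := 2; ntypes := 2;
     road_src := fun=> false; road_dst := fun=> true;
     ncomm := 2; source := fun=> false; dest := fun=> true;
     demand := fun=> 1%:nng; vtype := id;
     coef := fun i j => if i == j then 1%:nng else k;
     offset := fun=> 0%:nng |}.

Section TwoRoads.
Context {R : realType} (k : {nonneg R}).
Notation G := (two_roads k).

Fact road_path_subproof (e : 'I_2) : (size [:: e] <= #|node G|)%N.
Proof. by rewrite card_bool. Qed.

Definition road_path (e : 'I_2) : road_seq G := Bseq (road_path_subproof e).

(** Both roads lead from [false] to [true], so the empty walk misses the destination and no road can
    follow another. *)
Lemma in_pathsE (r : 'I_(ncomm G)) (p : road_seq G) :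
  (p \in paths r) = (size p == 1%N).
Proof. by rewrite inE /simple_walk; case: p => -[|e [|e' p]] hp. Qed.

Lemma big_paths (r : 'I_(ncomm G)) (P : pred (road_seq G))
    (F : road_seq G -> R) :
  \sum_(p in paths r | P p) F p = \sum_(e | P (road_path e)) F (road_path e).
Proof.
(* The default [ord0] of [head] is harmless, since paths are nonempty. *)
rewrite (reindex_onto road_path (fun p => head ord0 p)).
  by apply: eq_bigl => e; rewrite in_pathsE /= eqxx andbT.
move=> p /andP[]; rewrite in_pathsE => sz1 _; apply: val_inj => /=.
by case: (bseqval p) sz1 => [|e []].
Qed.

Lemma feasible_flowE (f : path_flow G) :
  feasible_flow f <-> forall j, \sum_i (f j (road_path i))%:num = 1.
Proof.
have sumE j : \sum_(p in paths j) (f j p)%:num =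
    \sum_i (f j (road_path i))%:num.
  by rewrite -(big_paths j predT (fun p => (f j p)%:num)); apply: eq_bigl => p;
    rewrite andbT.
by split=> hf j; have := hf j; rewrite sumE.
Qed.

(** Type [j] belongs to commodity [j] alone, and the only path through road [i] is [road_path i], so
    both sums have one term. *)
Lemma inducesE (f : path_flow G) (z : routing G) :
  induces f z <-> forall i j, (z i j)%:num = (f j (road_path i))%:num.
Proof.
have sumE (i j : 'I_2) : \sum_(r : 'I_(ncomm G) | vtype r == j)
    \sum_(p in paths r | i \in (p : seq 'I_2)) (f r p)%:num =
    (f j (road_path i))%:num.
  rewrite (big_pred1 j) // (big_paths j (fun p => i \in (p : seq _))).
  by rewrite (big_pred1 i) // => e; rewrite mem_seq1 eq_sym.
by split=> hz i j; rewrite hz sumE.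
Qed.

Lemma feasibleE (z : routing G) :
  feasible z <-> forall j, \sum_i (z i j)%:num = 1.
Proof.
split=> [[f [/feasible_flowE hf /inducesE hz]] j | hz].
  by rewrite -(hf j); apply: eq_bigr => i _.
exists (fun r p => z (head ord0 p) r).
by split; [apply/feasible_flowE | apply/inducesE].
Qed.

(** Each path is a single road, so the Wardrop inequality holds as an equality, whatever the
    flow. *)
Lemma wardrop_eq_cost (tau : 'I_(nroads G) -> R) (z : routing G) : feasible z ->
  (forall i i', latency z i + tau i = latency z i' + tau i') -> wardrop tau z.
Proof.
move=> [f [hf hz]] eq_cost; exists f; split=> // r p p'.
rewrite !in_pathsE; case: p p' => [[|e []] // ?] [[|e' []] // ?] _ _ _ /=.
by rewrite !big_seq1 (eq_cost e e').
Qed.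

(** Taken at [id] for the optimum and at [@rev_ord 2], which exchanges the two indices, for the
    equilibrium. *)
Definition assigned_routing (s : 'I_2 -> 'I_2) : routing G :=
  fun i j => if i == s j then 1%:nng else 0%:nng.

Lemma feasible_assigned s : feasible (assigned_routing s).
Proof.
apply/feasibleE => j; rewrite (bigD1 (s j)) //= big1 => [|i /negbTE ne_i].
  by rewrite /assigned_routing eqxx addr0.
by rewrite /assigned_routing ne_i.
Qed.

Lemma social_costE (z : routing G) : social_cost z =
  ((z ord0 ord0)%:num + (z ord0 ord_max)%:num) *
  ((z ord0 ord0)%:num + k%:num * (z ord0 ord_max)%:num) +
  ((z ord_max ord0)%:num + (z ord_max ord_max)%:num) *
  (k%:num * (z ord_max ord0)%:num + (z ord_max ord_max)%:num).
Proof.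
rewrite /social_cost /latency !big_ord_recr !big_ord0 /=.
have -> : widen_ord (leqnSn 1) ord_max = ord0 :> 'I_2 by apply: val_inj.
by rewrite /= !mul1r !add0r !addr0.
Qed.

Lemma social_cost_id : social_cost (assigned_routing id) = 2.
Proof. by rewrite social_costE /=; ring. Qed.

Lemma social_cost_rev :
  social_cost (assigned_routing (@rev_ord 2)) = 2 * k%:num.
Proof. by rewrite social_costE /=; ring. Qed.

Lemma social_cost_ge2 (z : routing G) :
  1 <= k%:num -> feasible z -> 2 <= social_cost z.
Proof.
move=> k1 /feasibleE hz; have := hz ord_max; have := hz ord0.
rewrite social_costE !big_ord_recr !big_ord0 /= !add0r.
have -> : widen_ord (leqnSn 1) ord_max = ord0 :> 'I_2 by apply: val_inj.
by move=> ac bd; apply: two_roads_cost_ge2.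
Qed.

Lemma optimal_id : 1 <= k%:num -> optimal (assigned_routing id).
Proof.
move=> k1; split; first exact: feasible_assigned.
by move=> z hz; rewrite social_cost_id social_cost_ge2.
Qed.

Lemma asymmetry_two_roads : 1 <= k%:num -> asymmetry G = k%:num%:E.
Proof.
move=> k1; have k0 : k%:num != 0 by rewrite gt_eqF ?(lt_le_trans ltr01).
have ratioE (i j j' : 'I_2) : @asym_ratio _ G i j j' =
    ((if i == j then 1 else k%:num) / (if i == j' then 1 else k%:num))%:E.
  (* The coefficient of type [i] on road [i] is [1], so no road has only zero coefficients. *)
  rewrite /asym_ratio ifF; last first.
    by apply/negbTE/forallPn; exists i; rewrite /= eqxx oner_eq0.
  by rewrite /=; do 2![case: ifP => _]; rewrite inver ?(negbTE k0) ?oner_eq0.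
apply/le_anti/andP; split.
  (* The possible ratios are [1], [k] and [1 / k], all at most [k]. *)
  do 3![apply/bigmax_leP; split=> [|? _]; first exact: leNye].
  rewrite ratioE lee_fin; do 2![case: ifP => _]; rewrite ?divr1 ?divff //.
  by rewrite div1r (le_trans _ k1) // invf_le1 // (lt_le_trans ltr01).
(* The value [k] is attained on the first road, by the second type against the first. *)
apply: (bigmax_sup ord0) => //; apply: (bigmax_sup ord_max) => //.
by apply: (bigmax_sup ord0) => //; rewrite ratioE divr1.
Qed.

(** On road [i], type [i] contributes [(0, 1, 1, 0)] and the other type [(1, 0, k, 0)]; changing
    road only changes their order. *)
Lemma toll_rev (T : tolling R) (i i' : 'I_2) :
  toll T (assigned_routing id) (assigned_routing (@rev_ord 2)) i =
  toll T (assigned_routing id) (assigned_routing (@rev_ord 2)) i'.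
Proof.
rewrite /toll; congr T; apply/eq_seq_msetP.
rewrite !enum_ordSl (size0nil (size_enum_ord 0)) /= /assigned_routing.
case: i i' => [[|[|//]] ?] [[|[|//]] ?]; rewrite -!val_eqE //=;
  exact/permPl/(perm_catC [:: _] [:: _]).
Qed.

Lemma wardrop_rev (T : tolling R) :
  wardrop (toll T (assigned_routing id) (assigned_routing (@rev_ord 2)))
    (assigned_routing (@rev_ord 2)).
Proof.
apply: wardrop_eq_cost (feasible_assigned _) _ => i i'.
rewrite (toll_rev T i i'); congr (_ + _).
(* Each road carries one unit, of the type whose coefficient there is [k]. *)
suff latE e : latency (assigned_routing (@rev_ord 2)) e = k%:num.
  by rewrite !latE.
rewrite /latency !big_ord_recr big_ord0 /=.
by case: e => [[|[|//]] ?] /=; rewrite mulr0 mulr1 !add0r !addr0.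
Qed.
End TwoRoads.

Theorem proposition1 (R : realType) (k : R) (hk : 1 <= k) (T : tolling R) :
  (k%:E <= price_of_anarchy T k)%E.
Proof.
(* The ratio of this instance is exactly [k], so membership in the set of ratios suffices. *)
pose K := NngNum (le_trans ler01 hk); apply: ereal_sup_ubound.
exists (two_roads K), (assigned_routing K id).
exists (assigned_routing K (@rev_ord 2)).
split; [exact: asymmetry_two_roads | exact: optimal_id
  | | exact: wardrop_rev |].
  by rewrite social_cost_id.
by rewrite social_cost_id social_cost_rev mulrC mulKf.
Qed.
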